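(* Let $(s_k)_{k\in\mathbb{N}}$ be a strictly increasing sequence of non-negative integers such that $$8^{s_{2k}}=o(s_{2k+1})\quad\text{and}\quad s_{2k-1}=o(s_{2k})\qquad\text{for }k\to\infty.$$ For $n\ge s_0$ let $$f_n(z_1,z_2):=\begin{cases}\bigl(\tfrac14z_1-\tfrac14z_2^2,\ \tfrac12z_2\bigr)&\text{if }s_{2k}\le n<s_{2k+1}\text{ for some }k\in\mathbb{N},\\[2pt]\bigl(\tfrac12z_1,\ \tfrac14z_2-\tfrac14z_1^2\bigr)&\text{if }s_{2k+1}\le n<s_{2k+2}\text{ for some }k\in\mathbb{N}.\end{cases}$$ If $(g_n)_{n\ge s_0}$ and $(h_n)_{n\ge s_0}$ are sequences in $\mathscr{F}$ such that, for every $n\ge s_0$, $g_n^1=f_n^1$, $h_n^1=I$, $g_n^2\in\mathscr{T}^2$, and $$h_{n+1}\circ f_n=g_n\circ h_n\quad\text{as }2\text{-jets},$$ then the sequence $(h_n^2)$ is not subexponential.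
   Context: Here the dimension is $d=2$. $\mathscr{F}\subset\mathbb{C}[[z_1,z_2]]^2$ is the space of two-component formal power series with vanishing zero order term; $f^k$ denotes the $k$-homogeneous part of $f\in\mathscr{F}$, and $\circ$ is formal composition. Equality as $2$-jets means equality of the homogeneous parts of degrees $1$ and $2$. $\mathscr{T}^2$ is the space of strictly triangular $2$-homogeneous polynomial maps of $\mathbb{C}^2$, i.e. the maps $(z_1,z_2)\mapsto(0,a z_1^2)$ with $a\in\mathbb{C}$. A sequence $(u_n)$ in a finite dimensional normed space is subexponential if for every $\theta>1$ there is $A>0$ with $|u_n|\le A\theta^n$ for all indices $n$. *)

(* Defs.v *)
From HB Require Import structures.
From mathcomp Require Import all_boot all_order all_algebra.
From mathcomp Require Import complex mpoly.
From mathcomp Require Import reals.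

Set Implicit Arguments.
Unset Strict Implicit.
Unset Printing Implicit Defensive.

Import Order.TTheory GRing.Theory Num.Theory.
Local Open Scope ring_scope.

Section FormalMaps.
Context {d : nat} {K : comNzRingType}.

(* A formal power series is given by its coefficients: [p m] is the
   coefficient of the monomial ['X_[m]]. *)
Definition fps : Type := 'X_{1..d} -> K.

Definition formal_map : Type := 'I_d -> fps.

Definition poly_map : Type := 'I_d -> {mpoly K[d]}.

Definition zero_at0 (f : formal_map) : Prop := forall i, f i 0%MM = 0.

Definition formal_of_poly (p : poly_map) : formal_map := fun i m => (p i)@_m.

Definition fps_trunc (N : nat) (p : fps) : {mpoly K[d]} :=
  \sum_(m : 'X_{1..d < N.+1}) p m *: 'X_[m].

(* Formal composition [h o f], meaningful when [zero_at0 f] holds: the products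
   of [k] components of [f] then have no term of degree [< k], so that the
   coefficient of ['X_[m]] in [h o f] only involves the coefficients of [h] and
   [f] of degree at most [mdeg m]. *)
Definition fcomp (h f : formal_map) : formal_map := fun i m =>
  (fps_trunc (mdeg m) (h i) \mPo [tuple fps_trunc (mdeg m) (f j) | j < d])@_m.

Definition hpart (k : nat) (f : formal_map) : poly_map := fun i =>
  \sum_(m : 'X_{1..d < k.+1} | mdeg m == k) f i m *: 'X_[m].

Definition id_map : poly_map := fun i => 'X_i.

Definition jet2_eq (f g : formal_map) : Prop :=
  hpart 1 f = hpart 1 g /\ hpart 2 f = hpart 2 g.

End FormalMaps.

Arguments fps : clear implicits.
Arguments formal_map : clear implicits.
Arguments poly_map : clear implicits.

Definition mk_map2 {T : Type} (p q : T) : 'I_2 -> T :=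
  fun i => if i == ord0 then p else q.

Definition z1 {K : comNzRingType} : {mpoly K[2]} := 'X_ord0.
Definition z2 {K : comNzRingType} : {mpoly K[2]} := 'X_ord_max.

Definition triangular2 {K : comNzRingType} (p : poly_map 2 K) : Prop :=
  exists a : K, p = mk_map2 0 (a *: z1 ^+ 2).

(* Maximum of the moduli of the coefficients.  On the finite dimensional space
   of [k]-homogeneous maps all norms are equivalent, so the choice of this one
   does not affect subexponentiality. *)
Definition coef_norm {d : nat} {R : realType} (p : poly_map d R[i]) : R :=
  \big[Num.max/0]_(i < d) \big[Num.max/0]_(m <- msupp (p i)) ComplexField.Normc.normc (p i)@_m.

(* The sequence is indexed by the integers [n >= n0]; [N] is the norm. *)
Definition subexponential {R : realType} {V : Type} (N : V -> R)
    (n0 : nat) (u : nat -> V) : Prop :=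
  forall theta : R, 1 < theta -> exists2 A : R, 0 < A &
    forall n, (n0 <= n)%N -> N (u n) <= A * theta ^+ n.

(* Main.v *)
Require Import Defs.
From HB Require Import structures.
From mathcomp Require Import all_boot all_order all_algebra.
From mathcomp Require Import complex mpoly.
From mathcomp Require Import classical_sets reals topology normedtype landau.
From mathcomp Require Import ring lra zify.

Set Implicit Arguments.
Unset Strict Implicit.
Unset Printing Implicit Defensive.

Import Order.TTheory GRing.Theory Num.Theory.
Import numFieldNormedType.Exports.
Local Open Scope classical_set_scope.
Local Open Scope ring_scope.

(** Let [c_n] be the coefficient of [z2 ^ 2] in the first component of [h_n].
    The quadratic part of [g_n] has zero first component, so the first component
    of the conjugacy equation leaves no freedom for [c_n]: comparing coefficients
    of [z2 ^ 2] there ([conjugacy_axis2]) gives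
      [- 1/4 + c_(n+1) / 4 = c_n / 4]  and  [c_(n+1) / 16 = c_n / 2]
    in the two kinds of phases, that is [c_(n+1) = c_n + 1] on
    [s_(2k) <= n < s_(2k+1)] and [c_(n+1) = 8 c_n] on
    [s_(2k+1) <= n < s_(2k+2)].

    Such a sequence is not subexponential; [theta = 2] already fails
    ([not_bounded_by_pow2]).  The real parts [x_n] of [c_n] satisfy the same
    recurrences.  If [|x_n| <= A 2^n], then [x_(s_(2k)) = O(8^(s_(2k)))] is
    negligible against the [s_(2k+1) - s_(2k)] unit increments that follow, so
    that [x_(s_(2k+1)) >= 1] for large [k].  The next phase is so long that it
    multiplies this by at least [8^(2 r / 3) = 4^r] where [r = s_(2k+2)],
    which exceeds [A 2^r].

    Coefficients of the powers of [z2] are those of the restriction to the axis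
    [z1 = 0].  This restriction is a ring morphism to univariate polynomials
    ([axis]) and sends each component of [f_n] to a multiple of a power of
    the variable, which makes the compositions computable. *)

(** * Coefficients of truncations and homogeneous parts *)

Section Coefficients.
Context {d : nat} {K : comNzRingType}.
Implicit Types (p : fps d K) (f g h : formal_map d K).

Lemma mcoeff_fps_trunc N p m :
  (fps_trunc N p)@_m = if (mdeg m <= N)%N then p m else 0.
Proof.
rewrite /fps_trunc raddf_sum /=.
under eq_bigr do rewrite mcoeffZ mcoeffX.
case: leqP => Hm.
  rewrite (bigD1 (BMultinom (Hm : (mdeg m < N.+1)%N))) //= eqxx mulr1.
  rewrite big1 ?addr0 // => i ne.
  by rewrite (_ : (bmnm i == m) = false) ?mulr0 //; apply: negbTE.
rewrite big1 // => i _; case: eqP => [e|_]; last by rewrite mulr0.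
by move: (bmdeg i); rewrite e ltnS leqNgt Hm.
Qed.

Lemma mcoeff_hpart k f i m :
  (hpart k f i)@_m = if mdeg m == k then f i m else 0.
Proof.
rewrite /hpart raddf_sum /=.
under eq_bigr do rewrite mcoeffZ mcoeffX.
case: eqP => [Hm|/eqP Hm].
  have Hb : (mdeg m < k.+1)%N by rewrite Hm.
  rewrite (bigD1 (BMultinom Hb)) /= ?Hm // eqxx mulr1.
  rewrite big1 ?addr0 // => i0 /andP[_ ne].
  by rewrite (_ : (bmnm i0 == m) = false) ?mulr0 //; apply: negbTE.
rewrite big1 // => i0 /eqP Hk; case: eqP => [e|_]; last by rewrite mulr0.
by move: Hm; rewrite -e Hk eqxx.
Qed.

Lemma fcomp_linear g h i j c m :
  fps_trunc (mdeg m) (g i) = c *: 'X_j -> fcomp g h i m = c * h j m.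
Proof.
move=> E; rewrite /fcomp E comp_mpolyZ comp_mpolyXU mcoeffZ.
by rewrite -tnth_nth tnth_mktuple mcoeff_fps_trunc leqnn.
Qed.

End Coefficients.

(** * Restriction to the axis *)

Section Axis.
Context {K : comNzRingType}.
Implicit Types (p q : {mpoly K[2]}) (f g h : formal_map 2 K).

Lemma eq_mnm2 (m m' : 'X_{1..2}) :
  (m == m') = (m ord0 == m' ord0) && (m ord_max == m' ord_max).
Proof.
apply/eqP/andP => [->|[/eqP e0 /eqP e1]] //; apply/mnmP => i.
case: (ord0 =P i) => [<-|/eqP n0]; first by rewrite e0.
by have -> : i = ord_max by apply/val_inj; case: i n0 => [[|[|]]].
Qed.

Definition axis_mon (k : nat) : 'X_{1..2} := (U_(ord_max) *+ k)%MM.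

(** Restriction to the line [z1 = 0], as a ring morphism. *)
Definition axis (p : {mpoly K[2]}) : {poly K} := mmap polyC (mk_map2 0 'X) p.

Lemma axis_monE k : (axis_mon k ord0 = 0%N) * (axis_mon k ord_max = k).
Proof. by rewrite /axis_mon !mulmnE !mnm1E /= mul1n. Qed.

Lemma mdeg_axis_mon k : mdeg (axis_mon k) = k.
Proof. by rewrite mdegMn mdeg1 mul1n. Qed.

Lemma axisX m : axis 'X_[m] = (m ord0 == 0%N)%:R *: 'X^(m ord_max).
Proof.
rewrite /axis mmapX /mmap1 big_ord_recr big_ord1 /= /mk_map2 /=.
rewrite (_ : widen_ord _ _ = ord0) ?expr0n /=; last exact/val_inj.
by case: eqP; rewrite ?scale1r ?scale0r ?mul1r ?mul0r.
Qed.

Lemma coef_axis p k : (axis p)`_k = p@_(axis_mon k).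
Proof.
rewrite {2}[p]mpolyE [p in LHS]mpolyE /axis !raddf_sum coef_sum /=.
apply: eq_bigr => m _; rewrite mmapZ mcoeffZ coefCM -/(axis _) axisX.
rewrite coefZ coefXn mcoeffX.
by rewrite eq_mnm2 !axis_monE -natrM mulnb [k == _]eq_sym.
Qed.

Lemma axis_fps_trunc N p :
  axis (fps_trunc N (fun m => p@_m)) = take_poly N.+1 (axis p).
Proof.
apply/polyP => k; rewrite coef_axis mcoeff_fps_trunc mdeg_axis_mon.
by rewrite coef_take_poly ltnS coef_axis.
Qed.

Lemma axis_comp p (lq : 2.-tuple {mpoly K[2]}) :
  axis (p \mPo lq) = \sum_(m <- msupp p)
    p@_m *: (axis (tnth lq ord0) ^+ m ord0
             * axis (tnth lq ord_max) ^+ m ord_max).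
Proof.
rewrite comp_mpolyE /axis raddf_sum; apply: eq_bigr => m _ /=.
rewrite mmapZ mul_polyC; congr (_ *: _).
rewrite rmorph_prod /= big_ord_recr big_ord1 /= !rmorphXn /=.
by rewrite (_ : widen_ord _ _ = ord0) //; exact/val_inj.
Qed.

(** On the axis, [z1 ^ i * z2 ^ j] becomes a multiple of ['X^(2 i + j)] after
    composition with [f], so only [z1] and [z2 ^ 2] contribute in degree 2. *)
Lemma fcomp_axis2 h f i a b :
  axis (fps_trunc 2 (f ord0)) = a *: 'X^2 ->
  axis (fps_trunc 2 (f ord_max)) = b *: 'X ->
  fcomp h f i (axis_mon 2)
    = a * h i U_(ord0)%MM + b ^+ 2 * h i (axis_mon 2).
Proof.
move=> Ha Hb.
rewrite /fcomp mdeg_axis_mon -coef_axis axis_comp !tnth_mktuple Ha Hb.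
set p := fps_trunc 2 (h i).
have hp m : (mdeg m <= 2)%N -> h i m = p@_m.
  by move=> Hm; rewrite mcoeff_fps_trunc Hm.
rewrite !hp ?mdeg_axis_mon ?mdeg1 //.
rewrite coef_sum [in a * _](mpolyE p) [in b ^+ 2 * _](mpolyE p).
rewrite !raddf_sum /= !mulr_sumr -big_split /=.
apply: eq_bigr => m _; rewrite !mcoeffZ !mcoeffX !exprZn -!exprM.
rewrite -scalerAl -scalerAr scalerA -exprD !coefZ coefXn.
rewrite !eq_mnm2 !axis_monE !mnm1E /=.
case: (m ord0) (m ord_max) => [|[|x]] [|[|[|y]]];
  rewrite ?mul2n ?doubleS /= ?addnS ?addSn /= ?mulr0 ?mulr1 ?addr0 ?add0r;
  rewrite ?expr0 ?expr1 ?mul1r ?mulr1 //; exact: mulrC.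
Qed.

Lemma axisZ1 c : axis (c *: z1) = 0.
Proof. by rewrite /axis mmapZ -/(axis _) axisX !mnm1E scale0r mulr0. Qed.

Lemma axisZ2 c : axis (c *: z2) = c *: 'X.
Proof. by rewrite /axis mmapZ -/(axis _) axisX !mnm1E scale1r mul_polyC. Qed.

Lemma axisZ1sq c : axis (c *: z1 ^+ 2) = 0.
Proof.
rewrite /axis mmapZ rmorphXn /= -/(axis _) axisX !mnm1E.
by rewrite scale0r expr0n mulr0.
Qed.

Lemma axisZ2sq c : axis (c *: z2 ^+ 2) = c *: 'X^2.
Proof.
rewrite /axis mmapZ rmorphXn /= -/(axis _) axisX !mnm1E.
by rewrite scale1r mul_polyC.
Qed.

Lemma axisB p q : axis (p - q) = axis p - axis q.
Proof. exact: raddfB. Qed.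

End Axis.

(** * The conjugacy equation on the axis *)

Section Conjugacy.
Context {K : comNzRingType}.
Implicit Types (f g h : formal_map 2 K).

Lemma hpart1_linear_sub_square (i j : 'I_2) a b f k :
  f k = (fun m => (a *: 'X_i - b *: 'X_j ^+ 2)@_m) ->
  hpart 1 f k = a *: 'X_i.
Proof.
move=> E; apply/mpolyP => m; rewrite mcoeff_hpart E mcoeffB.
rewrite !mcoeffZ mcoeffX mcoeffXn.
case: eqP => [m1|m1].
  case: ((U_(j) *+ 2)%MM =P m) => [e|_]; last by rewrite mulr0 subr0.
  by move: m1; rewrite -e mdegMn mdeg1.
case: (U_(i)%MM =P m) => [e|_]; last by rewrite mulr0.
by move: m1; rewrite -e mdeg1.
Qed.

(** A strictly triangular quadratic map has zero first component. *)
Lemma fps_trunc2_triangular g c :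
  zero_at0 g -> hpart 1 g ord0 = c *: z1 -> triangular2 (hpart 2 g) ->
  fps_trunc 2 (g ord0) = c *: z1.
Proof.
move=> g0 g1 [a g2]; apply/mpolyP => m; rewrite mcoeff_fps_trunc.
have := mcoeff_hpart 1 g ord0 m; rewrite g1 => ->.
case E: (mdeg m) => [|[|[|k]]] //=.
  by move/eqP: E; rewrite mdeg_eq0 => /eqP ->; rewrite g0.
have := mcoeff_hpart 2 g ord0 m; rewrite g2 E eqxx => <-.
by rewrite /mk_map2 /= mcoeff0.
Qed.

(** Since [g] is [c *: z1] up to order 2 in its first component, [g o h]
    contributes [c] times the coefficient of [h] there. *)
Lemma conjugacy_axis2 f g h h' a b c :
  axis (fps_trunc 2 (f ord0)) = a *: 'X^2 ->
  axis (fps_trunc 2 (f ord_max)) = b *: 'X ->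
  hpart 1 g ord0 = c *: z1 -> zero_at0 g -> triangular2 (hpart 2 g) ->
  hpart 1 h' = id_map -> jet2_eq (fcomp h' f) (fcomp g h) ->
  a + b ^+ 2 * h' ord0 (axis_mon 2) = c * h ord0 (axis_mon 2).
Proof.
move=> fa fb g1 g0 g2 h1 [_ /(congr1 (fun p => (p ord0)@_(axis_mon 2)))].
rewrite !mcoeff_hpart mdeg_axis_mon eqxx (fcomp_axis2 _ _ fa fb).
rewrite (@fcomp_linear _ _ g h ord0 ord0 c); last first.
  by rewrite mdeg_axis_mon (fps_trunc2_triangular g0 g1 g2).
have := mcoeff_hpart 1 h' ord0 U_(ord0)%MM.
by rewrite h1 mdeg1 eqxx mcoeffX eqxx => <-; rewrite mulr1.
Qed.

End Conjugacy.

(** * Growth of the coefficient *)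

Lemma Re_mcoeff_le_coef_norm (R : realType) d (p : poly_map d R[i]) i m :
  `|complex.Re (p i)@_m| <= coef_norm p.
Proof.
apply: (@le_trans _ _ (ComplexField.Normc.normc (p i)@_m)).
  case: ((p i)@_m) => a b /=; rewrite -(sqrtr_sqr a) ler_wsqrtr //.
  by rewrite lerDl sqr_ge0.
rewrite /coef_norm; apply: le_trans (le_bigmax _ _ i).
have [mp|] := boolP (m \in msupp (p i)); last first.
  rewrite -mcoeff_eq0 => /eqP ->.
  by rewrite ComplexField.Normc.normc0 bigmax_ge_id.
exact: (le_bigmax_seq _ m xpredT
          (fun k => ComplexField.Normc.normc (p i)@_k)).
Qed.

Section Growth.
Context {R : realType}.
Implicit Types (s : nat -> nat) (x : nat -> R).

Lemma ge_index s k : (forall j, (s j < s j.+1)%N) -> (k <= s k)%N.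
Proof.
by move=> s_incr; elim: k => // k IH; apply: leq_ltn_trans IH (s_incr k).
Qed.

Lemma arith_phase x m n : (m <= n)%N ->
  (forall i, (m <= i < n)%N -> x i.+1 = x i + 1) -> x n = x m + (n - m)%:R.
Proof.
move=> /subnK <-; elim: (n - m)%N => [|k IH] step; first by rewrite subnn addr0.
rewrite addSn step ?leq_addl ?leqnn // IH => [|i /andP[h1 h2]].
  by rewrite -addrA natr1 -addSn !addnK.
by apply: step; rewrite h1 ltnS ltnW.
Qed.

Lemma geom_phase x m n c : (m <= n)%N ->
  (forall i, (m <= i < n)%N -> x i.+1 = c * x i) -> x n = c ^+ (n - m) * x m.
Proof.
move=> /subnK <-; elim: (n - m)%N => [|k IH] step; first by rewrite subnn mul1r.
rewrite addSn step ?leq_addl ?leqnn // IH => [|i /andP[h1 h2]].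
  by rewrite -addSn !addnK exprS mulrA.
by apply: step; rewrite h1 ltnS ltnW.
Qed.

(** The factors 8 of a multiplicative phase beat [2 ^ n] as soon as the phase
    occupies at least two thirds of the time elapsed, because
    [8 ^ (2 n / 3) = 4 ^ n]. *)
Lemma not_bounded_by_pow2 s x (A : R) :
  (forall k, (s k < s k.+1)%N) ->
  (fun k : nat => 8 ^+ s (2 * k)%N : R^o) =o_\oo
    (fun k : nat => (s (2 * k + 1)%N)%:R : R^o) ->
  (fun k : nat => (s (2 * k - 1)%N)%:R : R^o) =o_\oo
    (fun k : nat => (s (2 * k)%N)%:R : R^o) ->
  (forall k n, (s (2 * k) <= n < s (2 * k + 1))%N -> x n.+1 = x n + 1) ->
  (forall k n, (s (2 * k + 1) <= n < s (2 * k + 2))%N -> x n.+1 = 8 * x n) ->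
  0 < A -> ~ (forall n, (s 0 <= n)%N -> `|x n| <= A * 2 ^+ n).
Proof.
move=> s_incr s_even s_odd x_even x_odd A0 bnd.
have A2 : 0 < (A + 2)^-1 by rewrite invr_gt0 addr_gt0.
(* With [m = s (2 k)] and [n = s (2 k + 1)], the constant [A + 2] yields
   [x n >= (A + 2) 8 ^ m - A 2 ^ m - m >= 8 ^ m >= 1]. *)
have [N1 _ H1] : \forall k \near \oo,
    (8 : R) ^+ s (2 * k)%N <= (A + 2)^-1 * (s (2 * k + 1)%N)%:R.
  have /eqoP/(_ _ A2) := s_even; apply: filterS => k /=.
  by rewrite normr_nat ger0_norm ?exprn_ge0.
have [N2 _ H2] : \forall k \near \oo,
    ((s (2 * k - 1)%N)%:R : R) <= 3^-1 * (s (2 * k)%N)%:R.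
  have /eqoP/(_ 3^-1) := s_odd; rewrite invr_gt0 ltr0n => /(_ isT).
  by apply: filterS => k /=; rewrite !normr_nat.
pose N3 := Num.bound A; pose k := maxn N1 (maxn N2 N3).
have {}H1 := H1 k (leq_maxl _ _).
have := H2 k.+1; rewrite (_ : 2 * k.+1 - 1 = 2 * k + 1)%N; last lia.
rewrite (_ : 2 * k.+1 = 2 * k + 2)%N; last lia.
have k2 : (N2 <= k.+1)%N by rewrite /k; lia.
move=> /(_ k2).
have s0 n : (s 0 <= s n)%N.
  by elim: n => // n IH; apply: leq_trans IH (ltnW (s_incr n)).
have l01 : (s (2 * k) <= s (2 * k + 1))%N by rewrite addn1 ltnW.
have l12 : (s (2 * k + 1) <= s (2 * k + 2))%N by rewrite addn1 addn2 ltnW.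
have E1 := arith_phase l01 (x_even k).
have E2 := geom_phase l12 (x_odd k).
have B0 := bnd _ (s0 (2 * k)%N).
have B2 := bnd _ (s0 (2 * k + 2)%N).
have big : (N3 <= s (2 * k + 2))%N.
  apply: leq_trans (ge_index _ s_incr); rewrite /k; lia.
move: E1 E2 B0 B2 H1 l01 l12 big.
set m := s (2 * k)%N; set n := s (2 * k + 1)%N; set r := s (2 * k + 2)%N.
move=> E1 E2 B0 B2 H1 l01 l12 big H2'.
have p28 : (2 : R) ^+ m <= 8 ^+ m.
  by apply: lerXn2r; rewrite ?nnegrE ?ler_nat ?ler0n.
have m8 : (m%:R : R) <= 8 ^+ m by rewrite -natrX ler_nat ltnW // ltn_expl.
have one8 : (1 : R) <= 8 ^+ m by rewrite exprn_ege1 // ler1n.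
have xn1 : 1 <= x n.
  move: H1; rewrite mulrC ler_pdivlMr ?addr_gt0 // => H1.
  have := ler_norm (- x m); rewrite normrN => nx.
  rewrite E1 natrB //; nra.
have r3 : (2 * r <= 3 * (r - n))%N.
  have : 3 * n%:R <= (r%:R : R) by lra.
  rewrite -natrM ler_nat; lia.
have : (4 : R) ^+ r <= A * 2 ^+ r.
  apply: le_trans B2; rewrite E2 normrM normrX normr_nat.
  have x1 : 1 <= `|x n| by apply: le_trans xn1 (ler_norm _).
  have h8 : (4 : R) ^+ r <= 8 ^+ (r - n).
    rewrite -!natrX ler_nat (_ : 4 = 2 ^ 2)%N // (_ : 8 = 2 ^ 3)%N //.
    by rewrite -!expnM leq_pexp2l.
  have : 0 <= (8 : R) ^+ (r - n) by rewrite exprn_ge0.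
  nra.
rewrite (_ : 4 = 2 * 2 :> R) ?exprMn; last by rewrite -natrM.
rewrite ler_pM2r ?exprn_gt0 // => le2A.
have : (r%:R : R) < 2 ^+ r by rewrite -natrX ltr_nat ltn_expl.
have : A < N3%:R by apply: archi_boundP; apply: ltW.
have : (N3%:R : R) <= r%:R by rewrite ler_nat.
lra.
Qed.
End Growth.

Theorem mainTheorem5 (R : realType) (s : nat -> nat)
  (s_incr : forall k, (s k < s k.+1)%N)
  (s_even : (fun k : nat => 8 ^+ s (2 * k)%N : R^o) =o_\oo
            (fun k : nat => (s (2 * k + 1)%N)%:R : R^o))
  (s_odd : (fun k : nat => (s (2 * k - 1)%N)%:R : R^o) =o_\oo
           (fun k : nat => (s (2 * k)%N)%:R : R^o))
  (f g h : nat -> formal_map 2 R[i])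
  (f_even : forall k n, (s (2 * k) <= n < s (2 * k + 1))%N ->
    f n = formal_of_poly
            (mk_map2 (4^-1 *: z1 - 4^-1 *: z2 ^+ 2) (2^-1 *: z2)))
  (f_odd : forall k n, (s (2 * k + 1) <= n < s (2 * k + 2))%N ->
    f n = formal_of_poly
            (mk_map2 (2^-1 *: z1) (4^-1 *: z2 - 4^-1 *: z1 ^+ 2)))
  (g0 : forall n, (s 0 <= n)%N -> zero_at0 (g n))
  (h0 : forall n, (s 0 <= n)%N -> zero_at0 (h n))
  (g_lin : forall n, (s 0 <= n)%N -> hpart 1 (g n) = hpart 1 (f n))
  (h_lin : forall n, (s 0 <= n)%N -> hpart 1 (h n) = id_map)
  (g_quad : forall n, (s 0 <= n)%N -> triangular2 (hpart 2 (g n)))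
  (conjugacy : forall n, (s 0 <= n)%N ->
    jet2_eq (fcomp (h n.+1) (f n)) (fcomp (g n) (h n))) :
  ~ subexponential coef_norm (s 0%N) (fun n => hpart 2 (h n)).
Proof.
move=> /(_ 2); rewrite ltr1n => /(_ isT) [A A0 bnd].
pose x n := complex.Re (h n ord0 (axis_mon 2)).
have s0 k : (s 0 <= s k)%N.
  by elim: k => // k IH; apply: leq_trans IH (ltnW (s_incr k)).
have neq0 k : (k.+1%:R : R[i]) != 0 by rewrite pnatr_eq0.
apply: (@not_bounded_by_pow2 R s x A s_incr s_even s_odd _ _ A0)
  => [k n kn|k n kn|n sn].
- have sn : (s 0 <= n)%N by apply: leq_trans (s0 _) (proj1 (andP kn)).
  have E : - 4^-1 + 2^-1 ^+ 2 * h n.+1 ord0 (axis_mon 2)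
           = 4^-1 * h n ord0 (axis_mon 2).
    apply: (conjugacy_axis2 _ _ _ (g0 n sn) (g_quad n sn)
             (h_lin _ (leqW sn)) (conjugacy n sn)).
    + rewrite (f_even _ _ kn) axis_fps_trunc /mk_map2 /= axisB axisZ1 axisZ2sq.
      rewrite sub0r take_poly_id ?scaleNr // size_polyN.
      by rewrite (leq_trans (size_scale_leq _ _)) // size_polyXn.
    + rewrite (f_even _ _ kn) axis_fps_trunc /mk_map2 /= axisZ2.
      by rewrite take_poly_id // (leq_trans (size_scale_leq _ _)) // size_polyX.
    + rewrite g_lin //; apply: (@hpart1_linear_sub_square _ ord0 ord_max _ 4^-1).
      by rewrite (f_even _ _ kn).
  rewrite /x; have -> :
      h n.+1 ord0 (axis_mon 2) = h n ord0 (axis_mon 2) + 1.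
    have -> : h n ord0 (axis_mon 2) = 4 * (4^-1 * h n ord0 (axis_mon 2)) by field.
    by rewrite -E; field.
  by rewrite raddfD.
- have sn : (s 0 <= n)%N by apply: leq_trans (s0 _) (proj1 (andP kn)).
  have E : 0 + 4^-1 ^+ 2 * h n.+1 ord0 (axis_mon 2)
           = 2^-1 * h n ord0 (axis_mon 2).
    apply: (conjugacy_axis2 _ _ _ (g0 n sn) (g_quad n sn)
             (h_lin _ (leqW sn)) (conjugacy n sn)).
    + rewrite (f_odd _ _ kn) axis_fps_trunc /mk_map2 /= axisZ1.
      by rewrite take_poly0r scale0r.
    + rewrite (f_odd _ _ kn) axis_fps_trunc /mk_map2 /= axisB axisZ2 axisZ1sq.
      by rewrite subr0 take_poly_id // (leq_trans (size_scale_leq _ _)) // size_polyX.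
    + rewrite g_lin //; apply: (@hpart1_linear_sub_square _ _ ord0 _ 0).
      by rewrite (f_odd _ _ kn) scale0r subr0.
  rewrite /x; have -> :
      h n.+1 ord0 (axis_mon 2) = h n ord0 (axis_mon 2) *+ 8.
    have -> : h n ord0 (axis_mon 2) = 2 * (2^-1 * h n ord0 (axis_mon 2)) by field.
    by rewrite -E; field.
  by rewrite raddfMn /= mulr_natl.
- apply: le_trans (bnd n sn).
  apply: le_trans (Re_mcoeff_le_coef_norm _ ord0 (axis_mon 2)).
  by rewrite mcoeff_hpart mdeg_axis_mon eqxx.
Qed.
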